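(* Let the matrix functions $Q(q)\in\mathbb{R}^{n\times m}$ and $A(q)\in\mathbb{R}^{n\times k}$ be such that $Q^\top=G_c^\perp$ is a left annihilator of $G_c$ (i.e. $Q^\top G_c=0$) of rank $m=n-k$ and $G_c^\top A$ is invertible. Consider the constrained port-Hamiltonian system $$\begin{bmatrix}\dot q\\ \dot p_0\end{bmatrix}=\begin{bmatrix}0_n&I_n\\ -I_n&-D_0\end{bmatrix}\begin{bmatrix}\nabla_q\mathcal{H}_0\\ \nabla_{p_0}\mathcal{H}_0\end{bmatrix}+\begin{bmatrix}0_{n\times m}&0_{n\times k}\\ G_0&G_c\end{bmatrix}\begin{bmatrix}u\\ \lambda\end{bmatrix},\quad y=G_0^\top\nabla_{p_0}\mathcal{H}_0,\quad \mathcal{H}_0=\tfrac12p_0^\top M_0^{-1}(q)p_0+\mathcal{V}(q),$$ subject to $G_c^\top(q)\dot q=0_{k\times1}$, under the change of momentum $\tilde p=\begin{bmatrix}\mu\\ p\end{bmatrix}=\begin{bmatrix}A^\top(q)\\ Q^\top(q)\end{bmatrix}p_0$ with $\mu\in\mathbb{R}^k$, $p\in\mathbb{R}^m$. The system dynamics can be equivalently expressed, without Lagrange multipliers, as $$\begin{bmatrix}\dot q\\ \dot p\end{bmatrix}=\begin{bmatrix}0_n&Q\\ -Q^\top&C-D\end{bmatrix}\begin{bmatrix}\nabla_q\mathcal{H}\\ \nabla_p\mathcal{H}\end{bmatrix}+\begin{bmatrix}0_{n\times m}\\ G\end{bmatrix}u,\qquad y=G^\top\nabla_p\mathcal{H},\qquad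 \mathcal{H}=\tfrac12p^\top M^{-1}p+\mathcal{V},$$ where $G=Q^\top G_0$, $M=Q^\top M_0Q$, $D=Q^\top D_0Q$ and $$C=Q^\top\left\{\left(\frac{\partial}{\partial q}\left[M_0Q(Q^\top M_0Q)^{-1}p\right]\right)^\top-\frac{\partial}{\partial q}\left[M_0Q(Q^\top M_0Q)^{-1}p\right]\right\}Q .$$
   Context: Here $q\in\mathbb{R}^n$ is the configuration, $p_0\in\mathbb{R}^n$ the momentum, $u,y\in\mathbb{R}^m$ the input and output with $m=n-k$, and $\lambda\in\mathbb{R}^k$ the Lagrange multipliers. $G_c(q)\in\mathbb{R}^{n\times k}$ has full rank, $G_0(q)\in\mathbb{R}^{n\times m}$, $[G_0(q)\ G_c(q)]$ is invertible, $M_0(q)=M_0^\top(q)>0$, $D_0(p_0,q)=D_0^\top(p_0,q)\ge0$, $\mathcal{V}(q)>0$; all data are smooth functions. $\nabla$ is the column gradient, $\frac{\partial}{\partial q}[\cdot]$ is the Jacobian matrix in $q$ with $p$ held fixed. In $D=Q^\top D_0Q$, the argument $p_0$ of $D_0$ is expressed through $(q,p)$ as $p_0=M_0Q(Q^\top M_0Q)^{-1}p$. ''Equivalently expressed'' means: for a given input $u(t)$, a curve $(q(t),p_0(t))$ satisfies the constrained system together with the constraint for some multiplier $\lambda(t)$ if and only if $(q(t),p(t))$ with $p=Q^\top p_0$ satisfies the reduced system and $p_0=M_0Q(Q^\top M_0Q)^{-1}p$; and the outputs $y$ coincide. *)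

(* Defs.v *)
From HB Require Import structures.
From mathcomp Require Import all_boot all_order all_algebra.
From mathcomp Require Import all_classical all_reals all_analysis.

Set Implicit Arguments.
Unset Strict Implicit.
Unset Printing Implicit Defensive.

Import Order.TTheory GRing.Theory Num.Theory.
Import numFieldNormedType.Exports.

Local Open Scope classical_set_scope.
Local Open Scope ring_scope.

(* In finite dimension, f is C^(j+1) iff it is differentiable and all its
   directional derivatives are C^j. *)
Fixpoint is_Ck (R : realType) (V W : normedModType R) (j : nat) (f : V -> W)
    {struct j} : Prop :=
  match j with
  | 0%N => continuous f
  | j'.+1 => (forall x, differentiable f x) /\ forall v, is_Ck j' ('D_v f)
  end.

Definition smooth (R : realType) (V W : normedModType R) (f : V -> W) : Prop :=
  forall j, is_Ck j f.

Definition posdef (R : realType) (n : nat) (S : 'M[R]_n) : Prop :=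
  S^T = S /\ forall x : 'cV[R]_n, x != 0 -> 0 < (x^T *m S *m x) 0 0.

Definition possemidef (R : realType) (n : nat) (S : 'M[R]_n) : Prop :=
  S^T = S /\ forall x : 'cV[R]_n, 0 <= (x^T *m S *m x) 0 0.

(* Column gradient and Jacobian matrix (row i, column j: derivative of the i-th
   component along the j-th coordinate); the library's jacobian is the transposed
   convention, for row vectors. *)
Definition grad (R : realType) (n : nat) (f : 'cV[R]_n -> R) (x : 'cV[R]_n) :
    'cV[R]_n :=
  \col_i 'D_(delta_mx i 0) f x.

Definition jac (R : realType) (n r : nat) (f : 'cV[R]_n -> 'cV[R]_r)
    (x : 'cV[R]_n) : 'M[R]_(r, n) :=
  \matrix_(i, j) ('D_(delta_mx j 0) f x) i 0.

Definition hamiltonian (R : realType) (n r : nat) (M : 'cV[R]_n -> 'M[R]_r)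
    (V : 'cV[R]_n -> R) (q : 'cV[R]_n) (p : 'cV[R]_r) : R :=
  2^-1 * (p^T *m invmx (M q) *m p) 0 0 + V q.

(* (q, p0) with input u, multiplier lam and output y is a trajectory, on the set of
   times J, of the port-Hamiltonian system subject to Gc^T q' = 0. *)
Definition constrained_pHs (R : realType) (n m k : nat)
    (M0 : 'cV[R]_n -> 'M[R]_n) (V : 'cV[R]_n -> R)
    (D0 : 'cV[R]_n -> 'cV[R]_n -> 'M[R]_n)
    (G0 : 'cV[R]_n -> 'M[R]_(n, m)) (Gc : 'cV[R]_n -> 'M[R]_(n, k))
    (J : set R) (u : R -> 'cV[R]_m) (lam : R -> 'cV[R]_k) (y : R -> 'cV[R]_m)
    (q p0 : R -> 'cV[R]_n) : Prop :=
  let H0 := hamiltonian M0 V in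
  forall t : R, J t ->
    let dq_H0 := grad (fun x => H0 x (p0 t)) (q t) in
    let dp_H0 := grad (H0 (q t)) (p0 t) in
    [/\ is_derive t 1 (fun s => col_mx (q s) (p0 s))
          (block_mx 0 1%:M (- 1%:M) (- D0 (p0 t) (q t)) *m col_mx dq_H0 dp_H0
           + block_mx 0 0 (G0 (q t)) (Gc (q t)) *m col_mx (u t) (lam t)),
        y t = (G0 (q t))^T *m dp_H0
      & (Gc (q t))^T *m 'D_1 q t = 0].

Definition reduced_pHs (R : realType) (n m : nat)
    (Q : 'cV[R]_n -> 'M[R]_(n, m)) (M : 'cV[R]_n -> 'M[R]_m) (V : 'cV[R]_n -> R)
    (C D : 'cV[R]_n -> 'cV[R]_m -> 'M[R]_m) (G : 'cV[R]_n -> 'M[R]_m)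
    (J : set R) (u y : R -> 'cV[R]_m) (q : R -> 'cV[R]_n) (p : R -> 'cV[R]_m) :
    Prop :=
  let H := hamiltonian M V in
  forall t : R, J t ->
    let dq_H := grad (fun x => H x (p t)) (q t) in
    let dp_H := grad (H (q t)) (p t) in
    is_derive t 1 (fun s => col_mx (q s) (p s))
      (block_mx 0 (Q (q t)) (- (Q (q t))^T) (C (q t) (p t) - D (q t) (p t))
         *m col_mx dq_H dp_H
       + col_mx 0 (G (q t)) *m u t)
    /\ y t = (G (q t))^T *m dp_H.

Definition red_mass (R : realType) (n m : nat) (M0 : 'cV[R]_n -> 'M[R]_n)
    (Q : 'cV[R]_n -> 'M[R]_(n, m)) (q : 'cV[R]_n) : 'M[R]_m :=
  (Q q)^T *m M0 q *m Q q.

(* The full momentum p0 expressed through (q, p) on the constraint. *)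
Definition full_momentum (R : realType) (n m : nat) (M0 : 'cV[R]_n -> 'M[R]_n)
    (Q : 'cV[R]_n -> 'M[R]_(n, m)) (q : 'cV[R]_n) (p : 'cV[R]_m) : 'cV[R]_n :=
  M0 q *m Q q *m invmx ((Q q)^T *m M0 q *m Q q) *m p.

Definition red_gyro (R : realType) (n m : nat) (M0 : 'cV[R]_n -> 'M[R]_n)
    (Q : 'cV[R]_n -> 'M[R]_(n, m)) (q : 'cV[R]_n) (p : 'cV[R]_m) : 'M[R]_m :=
  let dP := jac (fun x => full_momentum M0 Q x p) q in
  (Q q)^T *m (dP^T - dP) *m Q q.

Definition red_damping (R : realType) (n m : nat) (M0 : 'cV[R]_n -> 'M[R]_n)
    (D0 : 'cV[R]_n -> 'cV[R]_n -> 'M[R]_n)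
    (Q : 'cV[R]_n -> 'M[R]_(n, m)) (q : 'cV[R]_n) (p : 'cV[R]_m) : 'M[R]_m :=
  (Q q)^T *m D0 (full_momentum M0 Q q p) q *m Q q.

Definition red_input (R : realType) (n m : nat) (G0 : 'cV[R]_n -> 'M[R]_(n, m))
    (Q : 'cV[R]_n -> 'M[R]_(n, m)) (q : 'cV[R]_n) : 'M[R]_m :=
  (Q q)^T *m G0 q.

(* Main.v *)
(** The constraint forces the velocity [M0^-1 p0] into the range of [Q], which is
    the kernel of [Gc^T]; hence [p0 = P(q, p)] with [P = full_momentum M0 Q].
    Since [H(x, p) = H0(x, P(x, p))], the chain rule gives
    [grad_q H = grad_q H0 + (dP/dq)^T Q w], where [w = M^-1 p] and
    [grad_p0 H0 = Q w].  Differentiating the identity [Q(x)^T P(x, p) = p] along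
    [q' = Q w] gives [(Q^T)' p0 = - Q^T (dP/dq) Q w].  Together these turn
    [p' = (Q^T)' p0 + Q^T p0'] into the reduced equation, [C] being the
    antisymmetric combination of the two Jacobian terms.  Conversely [Q^T]
    annihilates the defect of the momentum equation, which therefore lies in the
    range of [Gc] and so defines the multiplier. *)
Require Import Defs.
From mathcomp Require Import all_boot all_order all_algebra perm.
From mathcomp Require Import all_classical all_reals all_analysis.

Set Implicit Arguments.
Unset Strict Implicit.
Unset Printing Implicit Defensive.

Import Order.TTheory GRing.Theory Num.Theory.
Import numFieldNormedType.Exports.

Local Open Scope classical_set_scope.
Local Open Scope ring_scope.

(** * Kernels, ranges and positive definite matrices *)

Section LinearAlgebra.
Context {R : realType}.

(** The range of [P] lies in the kernel of [N], and by rank-nullity both have dimension [b], so they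
    coincide. The argument is transposed because matrix subspaces are row spaces. It serves twice:
    to place the velocity in the range of [Q], and to produce the multiplier. *)
Lemma mulmx_eq0_range (n a b : nat) (N : 'M[R]_(a, n)) (P : 'M[R]_(n, b))
    (x : 'cV[R]_n) : n = (a + b)%N -> \rank N = a -> \rank P = b ->
  N *m P = 0 -> N *m x = 0 -> exists l, x = P *m l.
Proof.
move=> nab rN rP NP0 Nx0.
have PK : (P^T <= kermx N^T)%MS by apply/sub_kermxP; rewrite -trmx_mul NP0 trmx0.
have KP : (kermx N^T <= P^T)%MS.
  by rewrite -(mxrank_leqif_sup PK) mxrank_ker !mxrank_tr rN rP nab addKn.
have : (x^T <= P^T)%MS.
  by apply: submx_trans KP; apply/sub_kermxP; rewrite -trmx_mul Nx0 trmx0.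
case/submxP => l xl; exists l^T.
by apply: trmx_inj; rewrite xl trmx_mul trmxK.
Qed.

Lemma posdef_unitmx (n : nat) (S : 'M[R]_n) : posdef S -> S \in unitmx.
Proof.
case=> _ S_gt0; rewrite -row_free_unit -kermx_eq0; apply/rowV0P => v.
move=> /sub_kermxP vS0; apply: trmx_inj; rewrite trmx0.
have [//|/S_gt0] := eqVneq v^T 0.
by rewrite trmxK vS0 mul0mx mxE ltxx.
Qed.

(** The form at [x] is that of [S] at [B *m x], and full column rank of [B] keeps this vector
    nonzero. With [B] equal to [Q] it makes the reduced mass invertible. *)
Lemma posdef_congruence (n r : nat) (S : 'M[R]_n) (B : 'M[R]_(n, r)) :
  posdef S -> \rank B^T = r -> posdef (B^T *m S *m B).
Proof.
move=> [ST S_gt0] rB; split; first by rewrite !trmx_mul trmxK ST mulmxA.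
move=> x x0; have := S_gt0 (B *m x); rewrite trmx_mul !mulmxA; apply.
apply: contra_neq x0 => Bx0; apply: trmx_inj.
have fB : row_free B^T by rewrite /row_free rB.
by apply: (row_free_inj fB); rewrite -trmx_mul Bx0 !trmx0 mul0mx.
Qed.

Lemma trmx_scalar11 (x : 'M[R]_1) : x^T = x.
Proof. by rewrite [x]mx11_scalar tr_scalar_mx. Qed.

End LinearAlgebra.

(** * Differentiation of matrix-valued functions *)

Section MatrixCalculus.
Context {R : realType} {U : normedModType R}.

(** Coordinates are linear and continuous; conversely [f] is a finite sum of its entries times
    constant matrix units. *)
Lemma differentiable_mxP (a b : nat) (f : U -> 'M[R]_(a, b)) (x : U) :
  differentiable f x <-> forall i j, differentiable (fun y => f y i j) x.
Proof.
split=> [df i j|df].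
  exact: (differentiable_comp df (differentiable_coord _ _ _)).
have -> : f = \sum_(i < a) \sum_(j < b) (fun y => f y i j *: delta_mx i j).
  apply/funext => y; rewrite fct_sumE [LHS]matrix_sum_delta.
  by apply: eq_bigr => i _; rewrite fct_sumE.
apply: differentiable_sum => i; apply: differentiable_sum => j.
exact: differentiableZl.
Qed.

Lemma differentiable_prod (n : nat) (f : 'I_n -> U -> R) (x : U) :
  (forall i, differentiable (f i) x) ->
  differentiable (fun y => \prod_(i < n) f i y) x.
Proof.
elim: n f => [|n IHn] f df.
  under eq_fun do rewrite big_ord0.
  exact: differentiable_cst.
under eq_fun do rewrite big_ord_recl.
by apply: differentiableM => //; exact: IHn.
Qed.

Lemma differentiable_mulmx (a b c : nat) (f : U -> 'M[R]_(a, b))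
    (g : U -> 'M[R]_(b, c)) (x : U) : differentiable f x ->
  differentiable g x -> differentiable (fun y => f y *m g y) x.
Proof.
move=> /differentiable_mxP df /differentiable_mxP dg.
apply/differentiable_mxP => i j.
have -> : (fun y => (f y *m g y) i j)
    = \sum_(l < b) ((fun y => f y i l) * (fun y => g y l j)).
  by apply/funext => y; rewrite mxE fct_sumE.
by apply: differentiable_sum => l; exact: differentiableM.
Qed.

Lemma differentiable_trmx (a b : nat) (f : U -> 'M[R]_(a, b)) (x : U) :
  differentiable f x -> differentiable (fun y => (f y)^T) x.
Proof.
move=> /differentiable_mxP df; apply/differentiable_mxP => i j.
by under eq_fun do rewrite mxE.
Qed.

(** The Leibniz formula exhibits the determinant as a polynomial in the entries. *)
Lemma differentiable_det (n : nat) (f : U -> 'M[R]_n) (x : U) :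
  differentiable f x -> differentiable (fun y => \det (f y)) x.
Proof.
move=> /differentiable_mxP df.
have -> : (fun y => \det (f y))
    = \sum_(s : 'S_n) ((-1) ^+ s *: (fun y => \prod_(i < n) f y i (s i))).
  by apply/funext => y; rewrite fct_sumE.
elim/big_ind: _ => [|g h dg dh|s _].
- exact: differentiable_cst.
- exact: differentiableD.
- by apply: differentiableZ; exact: differentiable_prod.
Qed.

(** Cramer's rule: each entry is a cofactor over the determinant. As [invmx] is defined by cases,
    invertibility at every point makes this formula an equality of functions. *)
Lemma differentiable_invmx (n : nat) (f : U -> 'M[R]_n) (x : U) :
  differentiable f x -> (forall y, f y \in unitmx) ->
  differentiable (fun y => invmx (f y)) x.
Proof.
move=> df fU; apply/differentiable_mxP => i j.
have -> : (fun y => invmx (f y) i j)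
    = (fun y => (\det (f y))^-1) * (fun y => cofactor (f y) j i).
  by apply/funext => y; rewrite /invmx fU !mxE.
apply: differentiableM.
  apply: differentiableV; first exact: differentiable_det.
  by have := fU x; rewrite unitmxE unitfE.
apply: differentiableZ; apply: differentiable_det.
apply/differentiable_mxP => i' j'; under eq_fun do rewrite !mxE.
by move/differentiable_mxP : df.
Qed.

Lemma is_derive_mxP (a b : nat) (f : U -> 'M[R]_(a, b)) (df : 'M[R]_(a, b))
    (x v : U) :
  is_derive x v f df <-> forall i j, is_derive x v (fun y => f y i j) (df i j).
Proof.
split=> [[fx <-] i j|fx].
  rewrite derive_mx// mxE.
  by apply: DeriveDef => //; move/derivable_mxP : fx.
have fD : derivable f x v by apply/derivable_mxP => i j; case: (fx i j).
apply: DeriveDef => //; apply/matrixP => i j; rewrite derive_mx// mxE.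
by case: (fx i j).
Qed.

Lemma is_derive_mulmx (a b c : nat) (f : U -> 'M[R]_(a, b))
    (g : U -> 'M[R]_(b, c)) df dg (x v : U) :
  is_derive x v f df -> is_derive x v g dg ->
  is_derive x v (fun y => f y *m g y) (df *m g x + f x *m dg).
Proof.
move=> /is_derive_mxP fx /is_derive_mxP gx; apply/is_derive_mxP => i j.
have -> : (fun y => (f y *m g y) i j)
    = \sum_(l < b) ((fun y => f y i l) * (fun y => g y l j)).
  by apply/funext => y; rewrite mxE fct_sumE.
apply: is_derive_eq (is_derive_sum (fun l => is_deriveM (fx i l) (gx l j))) _.
rewrite !mxE -big_split; apply: eq_bigr => l _ /=.
by rewrite addrC /GRing.scale /= [g x l j * _]mulrC.
Qed.

Lemma is_derive_trmx (a b : nat) (f : U -> 'M[R]_(a, b)) df (x v : U) :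
  is_derive x v f df -> is_derive x v (fun y => (f y)^T) df^T.
Proof.
move=> /is_derive_mxP fx; apply/is_derive_mxP => i j; rewrite mxE.
by under eq_fun do rewrite mxE.
Qed.

Lemma is_derive_col_mx (a b c : nat) (f : U -> 'M[R]_(a, c))
    (g : U -> 'M[R]_(b, c)) df dg (x v : U) :
  is_derive x v (fun y => col_mx (f y) (g y)) (col_mx df dg) <->
  is_derive x v f df /\ is_derive x v g dg.
Proof.
split=> [/is_derive_mxP fgx|[/is_derive_mxP fx /is_derive_mxP gx]].
  split; apply/is_derive_mxP => i j.
    have := fgx (lshift b i) j; rewrite col_mxEu.
    by under eq_fun do rewrite col_mxEu.
  have := fgx (rshift a i) j; rewrite col_mxEd.
  by under eq_fun do rewrite col_mxEd.
apply/is_derive_mxP => i j; have [l ->|l ->] := split_ordP i.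
  by rewrite col_mxEu; under eq_fun do rewrite col_mxEu.
by rewrite col_mxEd; under eq_fun do rewrite col_mxEd.
Qed.

Lemma differentiable_is_derive (W : normedModType R) (f : U -> W) (x v : U) :
  differentiable f x -> is_derive x v f ('D_v f x).
Proof. by move=> /diff_derivable fx; apply: derivableP. Qed.

(** Chain rule along a curve: the differential of [f] is applied to the velocity, which yields a
    directional derivative. *)
Lemma is_derive_comp1 (W : normedModType R) (f : U -> W) (q : R -> U) dq (t : R) :
  is_derive t 1 q dq -> differentiable f (q t) ->
  is_derive t 1 (f \o q) ('D_dq f (q t)).
Proof.
move=> [/derivable1_diffP qt <-] fqt.
have fq : differentiable (f \o q) t by exact: differentiable_comp.
apply: DeriveDef; first exact/derivable1_diffP.
by rewrite (deriveE _ fq) diff_comp// (deriveE _ fqt) (deriveE _ qt).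
Qed.

End MatrixCalculus.

(** * Jacobians and gradients of quadratic Hamiltonians *)

Section Gradients.
Context {R : realType}.

Lemma jac_mulmx (n r : nat) (f : 'cV[R]_n -> 'cV[R]_r) (x v : 'cV[R]_n) :
  differentiable f x -> jac f x *m v = 'D_v f x.
Proof.
move=> fx; have -> : v = \sum_j v j 0 *: delta_mx j 0.
  rewrite [LHS]matrix_sum_delta; apply: eq_bigr => j _.
  by rewrite big_ord1.
rewrite (deriveE _ fx) mulmx_sumr linear_sum /=; apply: eq_bigr => j _.
rewrite -scalemxAr [RHS]linearZ; congr (_ *: _).
by apply/colP => i; rewrite -colE !mxE (deriveE _ fx).
Qed.

(** Of the three product-rule terms, the two that differentiate [z] are one-by-one matrices and
    transposes of each other by symmetry of [S x]; they are equal, and the factor one half absorbs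
    their sum. *)
Lemma is_derive_quadratic (n r : nat) (S : 'cV[R]_n -> 'M[R]_r)
    (z : 'cV[R]_n -> 'cV[R]_r) dS dz (x v : 'cV[R]_n) :
  (S x)^T = S x -> is_derive x v S dS -> is_derive x v z dz ->
  is_derive x v (fun y => 2^-1 * ((z y)^T *m S y *m z y) 0 0)
    (2^-1 * ((z x)^T *m dS *m z x) 0 0 + (dz^T *m (S x *m z x)) 0 0).
Proof.
move=> ST Sx zx.
have := is_derive_mulmx (is_derive_mulmx (is_derive_trmx zx) Sx) zx.
move=> /is_derive_mxP /(_ 0 0) /(is_deriveZ 2^-1) /is_derive_eq; apply.
rewrite /GRing.scale /= !mulmxDl.
have -> : (z x)^T *m S x *m dz = dz^T *m (S x *m z x).
  by rewrite -[LHS]trmx_scalar11 !trmx_mul trmxK ST.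
rewrite -mulmxA; set a := dz^T *m _; set b := _ *m z x.
rewrite addrAC -mulr2n mxE mulmxnE mulrDr.
by rewrite -(mulr_natl (a 0 0)) mulKf ?pnatr_eq0// addrC.
Qed.

Lemma grad_hamiltonian_momentum (n r : nat) (M : 'cV[R]_n -> 'M[R]_r)
    (V : 'cV[R]_n -> R) (q : 'cV[R]_n) (p : 'cV[R]_r) :
  (M q)^T = M q -> grad (hamiltonian M V q) p = invmx (M q) *m p.
Proof.
move=> MT; apply/colP => i; rewrite mxE.
have NT : (invmx (M q))^T = invmx (M q) by rewrite trmx_inv MT.
have /= dK := @is_derive_quadratic r r (cst (invmx (M q))) id _ _ p
  (delta_mx i 0) NT (is_derive_cst _ _ _) (is_derive_id _ _).
have dV := is_derive_cst (V q) p (delta_mx i 0).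
have /= [_ ->] := is_deriveD dK dV.
by rewrite mulmx0 mul0mx mxE mulr0 add0r addr0 trmx_delta -rowE mxE.
Qed.

End Gradients.

(** * Momentum, energy and forces on the constraint *)

Section Reduction.
Context {R : realType} {n m : nat}.
Context {M0 : 'cV[R]_n -> 'M[R]_n} {V : 'cV[R]_n -> R}
  {Q : 'cV[R]_n -> 'M[R]_(n, m)}.
Hypotheses (M0_diff : forall x, differentiable M0 x)
  (V_diff : forall x, differentiable V x)
  (Q_diff : forall x, differentiable Q x)
  (M0_posdef : forall x, posdef (M0 x)) (Q_rank : forall x, \rank (Q x)^T = m).

Lemma red_mass_posdef x : posdef (red_mass M0 Q x).
Proof. exact: posdef_congruence. Qed.

Lemma red_mass_unitmx x : (Q x)^T *m M0 x *m Q x \in unitmx.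
Proof. exact: posdef_unitmx (red_mass_posdef x). Qed.

Lemma annihilator_full_momentum x p : (Q x)^T *m full_momentum M0 Q x p = p.
Proof.
by rewrite /full_momentum !mulmxA mulmxV ?mul1mx// red_mass_unitmx.
Qed.

Lemma invmx_full_momentum x p :
  invmx (M0 x) *m full_momentum M0 Q x p
  = Q x *m (invmx (red_mass M0 Q x) *m p).
Proof.
by rewrite /full_momentum /red_mass -!mulmxA mulKmx// posdef_unitmx.
Qed.

(** Projecting by [(Q x)^T] gives [red_mass] times [w], and the inverse inside [full_momentum]
    recovers [w]. Thus a momentum whose velocity lies in the range of [Q] is determined by its
    projection. *)
Lemma full_momentum_velocity x w :
  M0 x *m (Q x *m w) = full_momentum M0 Q x ((Q x)^T *m (M0 x *m (Q x *m w))).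
Proof.
have -> : (Q x)^T *m (M0 x *m (Q x *m w)) = (Q x)^T *m M0 x *m Q x *m w.
  by rewrite !mulmxA.
by rewrite /full_momentum -[RHS]mulmxA mulKmx ?red_mass_unitmx// mulmxA.
Qed.

(** The matrix factor is separated from [p], since along a trajectory both vary with time. *)
Lemma differentiable_full_momentum_mx x : differentiable
  (fun y => M0 y *m Q y *m invmx ((Q y)^T *m M0 y *m Q y)) x.
Proof.
have dM0Q y : differentiable (fun y => M0 y *m Q y) y.
  exact: differentiable_mulmx.
apply: differentiable_mulmx => //; apply: differentiable_invmx.
  apply: differentiable_mulmx => //; apply: differentiable_mulmx => //.
  exact: differentiable_trmx.
exact: red_mass_unitmx.
Qed.

Lemma differentiable_full_momentum p x :
  differentiable (fun y => full_momentum M0 Q y p) x.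
Proof.
apply: differentiable_mulmx; first exact: differentiable_full_momentum_mx.
exact: differentiable_cst.
Qed.

(** With P the full momentum and w the reduced velocity, P^T M0^-1 P = P^T Q w = p^T w. *)
Lemma hamiltonian_full_momentum x p :
  hamiltonian (red_mass M0 Q) V x p
  = hamiltonian M0 V x (full_momentum M0 Q x p).
Proof.
rewrite /hamiltonian -[in RHS]mulmxA invmx_full_momentum mulmxA.
rewrite -[_^T *m Q x]trmxK trmx_mul trmxK annihilator_full_momentum.
by rewrite mulmxA.
Qed.

(** The same quadratic derivative is taken with the momentum moving with [x] and with it frozen at
    [q]; the two differ only by the Jacobian term. *)
Lemma grad_red_hamiltonian q p :
  grad (fun x => hamiltonian (red_mass M0 Q) V x p) q
  = grad (fun x => hamiltonian M0 V x (full_momentum M0 Q q p)) q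
    + (jac (fun x => full_momentum M0 Q x p) q)^T
      *m (Q q *m (invmx (red_mass M0 Q q) *m p)).
Proof.
apply/colP => i; rewrite !mxE; set v := delta_mx i 0.
have NT : (invmx (M0 q))^T = invmx (M0 q).
  by rewrite trmx_inv; case: (M0_posdef q) => ->.
have dN : is_derive q v (fun x => invmx (M0 x)) ('D_v (fun x => invmx (M0 x)) q).
  apply: differentiable_is_derive; apply: differentiable_invmx => // y.
  exact: posdef_unitmx.
have dP := differentiable_is_derive v (differentiable_full_momentum p q).
have dV := differentiable_is_derive v (V_diff q).
have dP0 := is_derive_cst (full_momentum M0 Q q p) q v.
have /= [_ dH] := is_deriveD (is_derive_quadratic NT dN dP) dV.
have /= [_ dH0] := is_deriveD (is_derive_quadratic NT dN dP0) dV.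
under eq_fun do rewrite hamiltonian_full_momentum.
rewrite [LHS]dH [X in _ = X + _]dH0 trmx0 mul0mx [X in _ = _ + X + _ + _]mxE addr0 addrAC.
rewrite -invmx_full_momentum; congr (_ + _).
by rewrite mxE; apply: eq_bigr => j _; rewrite !mxE.
Qed.

Lemma annihilator_transport q p w :
  ('D_(Q q *m w) Q q)^T *m full_momentum M0 Q q p
  = - ((Q q)^T *m (jac (fun x => full_momentum M0 Q x p) q *m (Q q *m w))).
Proof.
have dP := differentiable_full_momentum p q.
have dQ := differentiable_is_derive (Q q *m w) (Q_diff q).
have [_] := is_derive_mulmx (is_derive_trmx dQ)
  (differentiable_is_derive (Q q *m w) dP).
under eq_fun do rewrite annihilator_full_momentum.
rewrite derive_cst jac_mulmx// => /esym/eqP.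
by rewrite addr_eq0 => /eqP.
Qed.

(** The transposed Jacobian term of the gradient cancels the one in [red_gyro]; the remaining
    Jacobian term is the transport of [Q] along the velocity. *)
Lemma red_force q p (w := invmx (red_mass M0 Q q) *m p)
    (p0 := full_momentum M0 Q q p) :
  - (Q q)^T *m grad (fun x => hamiltonian (red_mass M0 Q) V x p) q
    + red_gyro M0 Q q p *m w
  = ('D_(Q q *m w) Q q)^T *m p0
    - (Q q)^T *m grad (fun x => hamiltonian M0 V x p0) q.
Proof.
rewrite grad_red_hamiltonian annihilator_transport /red_gyro -/w -/p0.
rewrite mulmxBr !mulmxBl mulmxDr !mulNmx -!mulmxA.
by rewrite subrKA addrC.
Qed.

End Reduction.

(** * Equivalence of the constrained and reduced systems *)

Theorem proposition3 (R : realType) (m k : nat)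
    (M0 : 'cV[R]_(m + k) -> 'M[R]_(m + k)) (V : 'cV[R]_(m + k) -> R)
    (D0 : 'cV[R]_(m + k) -> 'cV[R]_(m + k) -> 'M[R]_(m + k))
    (G0 : 'cV[R]_(m + k) -> 'M[R]_(m + k, m))
    (Gc : 'cV[R]_(m + k) -> 'M[R]_(m + k, k))
    (Q : 'cV[R]_(m + k) -> 'M[R]_(m + k, m))
    (A : 'cV[R]_(m + k) -> 'M[R]_(m + k, k))
    (smooth_M0 : smooth M0) (smooth_V : smooth V)
    (smooth_D0 : smooth
       (fun x : 'cV[R]_(m + k) * 'cV[R]_(m + k) => D0 x.1 x.2))
    (smooth_G0 : smooth G0) (smooth_Gc : smooth Gc)
    (smooth_Q : smooth Q) (smooth_A : smooth A)
    (M0_posdef : forall q, posdef (M0 q))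
    (V_gt0 : forall q, 0 < V q)
    (D0_possemidef : forall p0 q, possemidef (D0 p0 q))
    (Gc_full_rank : forall q, \rank (Gc q) = k)
    (G0Gc_unit : forall q, row_mx (G0 q) (Gc q) \in unitmx)
    (Q_annihilator : forall q, (Q q)^T *m Gc q = 0)
    (Q_rank : forall q, \rank (Q q)^T = m)
    (GcA_unit : forall q, (Gc q)^T *m A q \in unitmx)
    (J : set R) (J_open : open J) (J_interval : is_interval J)
    (u y : R -> 'cV[R]_m) (q p0 : R -> 'cV[R]_(m + k))
    (mu : R -> 'cV[R]_k) (p : R -> 'cV[R]_m)
    (momentum_change : forall t, J t ->
       col_mx (mu t) (p t) = col_mx (A (q t))^T (Q (q t))^T *m p0 t) :
  (exists lam : R -> 'cV[R]_k, constrained_pHs M0 V D0 G0 Gc J u lam y q p0)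
  <->
  reduced_pHs Q (red_mass M0 Q) V (red_gyro M0 Q) (red_damping M0 D0 Q)
    (red_input G0 Q) J u y q p
  /\ (forall t, J t -> p0 t = full_momentum M0 Q (q t) (p t)).
Proof.
have M0_diff : forall x, differentiable M0 x by case: (smooth_M0 1%N).
have V_diff : forall x, differentiable V x by case: (smooth_V 1%N).
have Q_diff : forall x, differentiable Q x by case: (smooth_Q 1%N).
(* Openness of [J] lets identities known only on [J] be differentiated at each of its points. *)
have J_near t : J t -> \forall s \near t, J s by move=> Jt; exact: open_nbhs_nbhs.
have pE t : J t -> p t = (Q (q t))^T *m p0 t.
  by move/momentum_change; rewrite mul_col_mx => /eq_col_mx[].
have GcTQ x : (Gc x)^T *m Q x = 0.
  by rewrite -[LHS]trmxK trmx_mul trmxK Q_annihilator trmx0.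
have GcT_rank x : \rank (Gc x)^T = k by rewrite mxrank_tr.
have Q_rank' x : \rank (Q x) = m by rewrite -mxrank_tr.
pose w t := invmx (red_mass M0 Q (q t)) *m p t.
have dH0E t : p0 t = full_momentum M0 Q (q t) (p t) ->
    grad (hamiltonian M0 V (q t)) (p0 t) = Q (q t) *m w t.
  move=> p0E; rewrite grad_hamiltonian_momentum; last by case: (M0_posdef (q t)).
  by rewrite p0E invmx_full_momentum.
have dHE t : grad (hamiltonian (red_mass M0 Q) V (q t)) (p t) = w t.
  rewrite grad_hamiltonian_momentum//.
  by case: (red_mass_posdef M0_posdef Q_rank (q t)).
have p_deriv t f : J t -> is_derive t 1 q (Q (q t) *m w t) ->
    is_derive t 1 p0 f ->
    is_derive t 1 p (('D_(Q (q t) *m w t) Q (q t))^T *m p0 t + (Q (q t))^T *m f).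
  move=> Jt dq dp0.
  apply: near_eq_is_derive (is_derive_mulmx
    (is_derive_trmx (is_derive_comp1 dq (Q_diff _))) dp0).
  by near=> s; rewrite [RHS]pE//; near: s; exact: J_near.
have constrainedE lam t :
    block_mx 0 1%:M (- 1%:M) (- D0 (p0 t) (q t))
      *m col_mx (grad (fun x => hamiltonian M0 V x (p0 t)) (q t))
           (grad (hamiltonian M0 V (q t)) (p0 t))
    + block_mx 0 0 (G0 (q t)) (Gc (q t)) *m col_mx (u t) lam
    = col_mx (grad (hamiltonian M0 V (q t)) (p0 t))
        (- grad (fun x => hamiltonian M0 V x (p0 t)) (q t)
         - D0 (p0 t) (q t) *m grad (hamiltonian M0 V (q t)) (p0 t)
         + (G0 (q t) *m u t + Gc (q t) *m lam)).
  rewrite !mul_block_col add_col_mx !mul0mx mul1mx add0r !addr0.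
  by rewrite !mulNmx mul1mx.
(* The reduced vector field is put in the form of [p_deriv], with [f] the momentum equation without
   its multiplier term. *)
have reducedE t :
    block_mx 0 (Q (q t)) (- (Q (q t))^T)
        (red_gyro M0 Q (q t) (p t) - red_damping M0 D0 Q (q t) (p t))
      *m col_mx (grad (fun x => hamiltonian (red_mass M0 Q) V x (p t)) (q t))
           (grad (hamiltonian (red_mass M0 Q) V (q t)) (p t))
    + col_mx 0 (red_input G0 Q (q t)) *m u t
    = col_mx (Q (q t) *m w t)
        (('D_(Q (q t) *m w t) Q (q t))^T *m full_momentum M0 Q (q t) (p t)
         + (Q (q t))^T *m
           (- grad (fun x =>
                hamiltonian M0 V x (full_momentum M0 Q (q t) (p t))) (q t)
            - D0 (full_momentum M0 Q (q t) (p t)) (q t) *m (Q (q t) *m w t)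
            + G0 (q t) *m u t)).
  rewrite mul_block_col mul_col_mx add_col_mx !mul0mx add0r addr0 dHE.
  congr col_mx; rewrite mulmxBl addrA red_force// /red_damping /red_input.
  by rewrite !mulmxDr !mulmxN !mulmxA !addrA.
split=> [[lam sys]|[sys p0E]].
- have dH0 t : J t ->
      [/\ is_derive t 1 q (grad (hamiltonian M0 V (q t)) (p0 t)),
          is_derive t 1 p0 (- grad (fun x => hamiltonian M0 V x (p0 t)) (q t)
            - D0 (p0 t) (q t) *m grad (hamiltonian M0 V (q t)) (p0 t)
            + (G0 (q t) *m u t + Gc (q t) *m lam t)),
          y t = (G0 (q t))^T *m grad (hamiltonian M0 V (q t)) (p0 t)
        & (Gc (q t))^T *m grad (hamiltonian M0 V (q t)) (p0 t) = 0].
    case/sys; rewrite constrainedE => /is_derive_col_mx[dq dp0] yE.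
    (* Replacing the velocity by its value turns the constraint into a condition on the momentum. *)
    by have [_ ->] := dq.
  have p0E t : J t -> p0 t = full_momentum M0 Q (q t) (p t).
    move=> Jt; rewrite pE//; have [_ _ _] := dH0 t Jt.
    rewrite grad_hamiltonian_momentum; last by case: (M0_posdef (q t)).
    move=> v0; have [z vz] :=
      mulmx_eq0_range (addnC m k) (GcT_rank _) (Q_rank' _) (GcTQ _) v0.
    have -> : p0 t = M0 (q t) *m (Q (q t) *m z).
      by rewrite -vz mulKVmx// posdef_unitmx.
    exact: full_momentum_velocity.
  split=> // H t Jt; rewrite {}/H /=; have [dq dp0 yE _] := dH0 t Jt.
  move: dq dp0 yE; rewrite (dH0E _ (p0E _ Jt)) => dq dp0 yE.
  split; last by rewrite dHE yE /red_input trmx_mul trmxK mulmxA.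
  rewrite reducedE; apply/is_derive_col_mx; split=> //.
  have := p_deriv _ _ Jt dq dp0; rewrite -p0E//.
  (* The constraint force disappears under projection by [Q^T]. *)
  by rewrite !mulmxDr [_ *m (Gc _ *m _)]mulmxA Q_annihilator mul0mx addr0.
- have dq t : J t -> is_derive t 1 q (Q (q t) *m w t).
    by case/sys; rewrite reducedE => /is_derive_col_mx[].
  (* The reduced system differentiates only [q] and [p]; differentiability of [p0] comes from its
     expression as a matrix in [q] times [p]. *)
  have p0_deriv t : J t -> is_derive t 1 p0 ('D_1 p0 t).
    move=> Jt; have [+ _] := sys t Jt; rewrite reducedE.
    case/is_derive_col_mx => _ dp; apply: derivableP.
    have dB := is_derive_comp1 (dq t Jt)
      (differentiable_full_momentum_mx M0_diff Q_diff M0_posdef Q_rank (q t)).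
    have [+ _] := is_derive_mulmx dB dp; apply: near_eq_derivable.
    by near=> s; rewrite [RHS]p0E//; near: s; exact: J_near.
  (* Keeping [J t] under the existential lets [choice] give a multiplier defined at all times; off
     [J] the value 0 is arbitrary. *)
  have lamP t : exists l, J t -> 'D_1 p0 t
      = - grad (fun x => hamiltonian M0 V x (p0 t)) (q t)
        - D0 (p0 t) (q t) *m (Q (q t) *m w t) + (G0 (q t) *m u t + Gc (q t) *m l).
    have [Jt|nJt] := pselect (J t); last by exists 0.
    pose f := - grad (fun x => hamiltonian M0 V x (p0 t)) (q t)
        - D0 (p0 t) (q t) *m (Q (q t) *m w t) + G0 (q t) *m u t.
    have : (Q (q t))^T *m ('D_1 p0 t - f) = 0.
      have [+ _] := sys t Jt; rewrite reducedE -p0E//.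
      case/is_derive_col_mx => _ [_ dp].
      have [_] := p_deriv _ _ Jt (dq t Jt) (p0_deriv t Jt).
      (* The derivative of [p] is known from the reduced system and from the product rule; the
         common transport term cancels, so [Q^T] gives [f] and the derivative of [p0] the same
         image. *)
      by rewrite dp => /addrI e; rewrite mulmxBr -e subrr.
    move=> /(mulmx_eq0_range erefl (Q_rank _) (Gc_full_rank _) (Q_annihilator _)).
    by case=> l e; exists l => _; rewrite addrA -/f -e addrC subrK.
  have [lam lamE] := choice lamP.
  exists lam => H0 t Jt; rewrite {}/H0 /=; have [_ yE] := sys t Jt.
  rewrite constrainedE (dH0E _ (p0E _ Jt)); split.
  + by apply/is_derive_col_mx; split; [exact: dq|rewrite -lamE//; exact: p0_deriv].
  + by rewrite yE dHE /red_input trmx_mul trmxK mulmxA.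
  + by have [_ ->] := dq t Jt; rewrite mulmxA GcTQ mul0mx.
Unshelve. all: by end_near. Qed.
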